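(* The function $\rho\circ\iota:\mathbb{T}\to\mathbb{R}$ attains its absolute maximum over the torus $\mathbb{T}$ at the point $c$. Moreover, $$Z=\frac12\left(\cos\frac{x'}{q}\pi\,\cos\frac{y}{q}\pi-\cos\frac{x}{q}\pi\,\cos\frac{y'}{q}\pi\right),$$ $Z$ is positive, and one has $$|V''-U''|<Z<V''+U''.$$
   Context: Fix integers $q\ge 5$ and $p\in\{2,\dots,q-2\}$ with $p$ coprime to $q$, and let $Q:=\frac pq$. For rationals in reduced form (with $\infty=\frac10$ allowed) write $\frac uv\wedge\frac st:=|ut-vs|$; two rationals $h,h'$ are Farey neighbors if $h\wedge h'=1$. Let $A=\frac{\alpha}{a},B=\frac{\beta}{b}\in[0,1]$ (in reduced form, $a,b\ge1$) be Farey neighbors such that $Q$ lies strictly between $A$ and $B$, at most one of $A,B$ is a Farey neighbor of $Q$, and at most one of $A,B$ is a Farey neighbor of $\infty$ (i.e. belongs to $\{0,1\}$). Let $X=\frac{\alpha+\beta}{a+b}$ and $Y=\frac{|\alpha-\beta|}{|a-b|}$ be the two common Farey neighbors of $A$ and $B$, let $x=X\wedge\infty$ and $y=Y\wedge\infty$ be their denominators, and let $x'=X\wedge Q$, $y'=Y\wedge Q$. Let $\mathbb{T}=(\mathbb{R}/2\pi\mathbb{Z})^2$, $\iota:\mathbb{T}\to\mathbb{R}^4$, $\iota(u,v)=(\cos u,\sin u,\cos v,\sin v)$, and let $c\in\mathbb{T}$ be the class of $\left(\frac{a+b}{q}\pi,\left[p\frac{a+b}{q}-(\alpha+\beta)\right]\pi\right)$.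 Let $\rho:\mathbb{R}^4\to\mathbb{R}$ be the linear form with coefficients $(U,U',V,V')$, where $$U=-(-1)^{\alpha+\beta}\cos\tfrac{(a+b)\pi}{q}\sin\tfrac{ap\pi}{q}\sin\tfrac{bp\pi}{q},\qquad U'=-(-1)^{\alpha+\beta}\sin\tfrac{(a+b)\pi}{q}\sin\tfrac{ap\pi}{q}\sin\tfrac{bp\pi}{q},$$ $$V=(-1)^{\alpha+\beta}\cos\tfrac{(a+b)p\pi}{q}\sin\tfrac{a\pi}{q}\sin\tfrac{b\pi}{q},\qquad V'=(-1)^{\alpha+\beta}\sin\tfrac{(a+b)p\pi}{q}\sin\tfrac{a\pi}{q}\sin\tfrac{b\pi}{q},$$ and let $$Z=(-1)^{\alpha+\beta}\left(\cos\tfrac{(a+b)p\pi}{q}\sin\tfrac{a\pi}{q}\sin\tfrac{b\pi}{q}-\cos\tfrac{(a+b)\pi}{q}\sin\tfrac{ap\pi}{q}\sin\tfrac{bp\pi}{q}\right),$$ $U''=\sqrt{U^2+U'^2}$, $V''=\sqrt{V^2+V'^2}$. *)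

(* Defs.v *)
From HB Require Import structures.
From mathcomp Require Import all_boot all_order all_algebra.
From mathcomp Require Import all_classical all_reals all_analysis.

Set Implicit Arguments.
Unset Strict Implicit.
Unset Printing Implicit Defensive.

Import Order.TTheory GRing.Theory Num.Theory.
Local Open Scope ring_scope.
Local Open Scope quotient_scope.

(* Q together with the point at infinity; [Fin] is a coercion. *)
Inductive slope := Fin of rat | Infty.
Coercion Fin : rat >-> slope.

Definition slope_num (h : slope) : int :=
  match h with Fin r => numq r | Infty => 1 end.

Definition slope_den (h : slope) : int :=
  match h with Fin r => denq r | Infty => 0 end.

(* u / v need not be in reduced form here; u / 0 is 1 / 0. *)
Definition fraction (u v : nat) : slope :=
  if v == 0%N then Infty else Fin (u%:Q / v%:Q).

(* numq and denq give the reduced form, so this is |u t - v s| for u / v and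
   s / t reduced. *)
Definition wedge (h k : slope) : nat :=
  `|(slope_num h * slope_den k - slope_den h * slope_num k)%R|%N.

Definition farey_neighbor (h k : slope) : bool := wedge h k == 1%N.

Section Torus.
Variable R : realType.

Definition twopiZ : {pred R} :=
  [pred t : R | `[< exists k : int, t = k%:~R * (2 * pi) >]].

Lemma twopiZ_zmod_closed : zmod_closed twopiZ.
Proof.
split=> [|s t]; first by apply/asboolP; exists 0; rewrite mul0r.
move=> /asboolP[k ->] /asboolP[l ->]; apply/asboolP.
by exists (k - l); rewrite intrB mulrBl.
Qed.

HB.instance Definition _ := GRing.isZmodClosed.Build R twopiZ twopiZ_zmod_closed.

Definition circle := Quotient.quot twopiZ.

Definition torus : Type := (circle * circle)%type.

Definition torus_class (u v : R) : torus := (\pi_circle u, \pi_circle v).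

Lemma periodicz (f : R -> R) (T : R) : (forall t, f (t + T) = f t) ->
  forall (k : int) t, f (t + k%:~R * T) = f t.
Proof.
move=> fT.
have fn (n : nat) t : f (t + n%:R * T) = f t.
  elim: n => [|n IHn]; first by rewrite mul0r addr0.
  by rewrite -natr1 mulrDl mul1r addrA fT IHn.
case=> n t; first exact: fn.
by rewrite NegzE mulrNz mulNr -{1}(fn n.+1) subrK.
Qed.

Lemma eq_circle_periodic (f : R -> R) (u v : R) :
  (forall t, f (t + 2 * pi) = f t) -> u = v %[mod circle] -> f u = f v.
Proof.
move=> fT /eqP; rewrite -Quotient.idealrBE => /asboolP[k uv].
by rewrite -(periodicz fT k v) -uv addrC subrK.
Qed.

Definition cos_circle (u : circle) : R := cos (repr u).

Definition sin_circle (u : circle) : R := sin (repr u).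

(* The choice of the representative [repr u] is irrelevant. *)
Lemma cos_circleE (u : R) : cos_circle (\pi_circle u) = cos u.
Proof.
apply: eq_circle_periodic; last by rewrite reprK.
by move=> t; rewrite mulr_natl cosD2pi.
Qed.

Lemma sin_circleE (u : R) : sin_circle (\pi_circle u) = sin u.
Proof.
apply: eq_circle_periodic; last by rewrite reprK.
by move=> t; rewrite mulr_natl sinD2pi.
Qed.

Definition row4 (w0 w1 w2 w3 : R) : 'rV[R]_4 :=
  \row_i [:: w0; w1; w2; w3]`_i.

Definition iota_torus (t : torus) : 'rV[R]_4 :=
  row4 (cos_circle t.1) (sin_circle t.1) (cos_circle t.2) (sin_circle t.2).

Definition linear_form (coef w : 'rV[R]_4) : R := \sum_i coef 0 i * w 0 i.

End Torus.

Arguments torus_class {R} u v.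
Arguments iota_torus {R} t.
Arguments linear_form {R} coef w.

(* Main.v *)
Require Import Defs.
From mathcomp Require Import all_boot all_order all_algebra.
From mathcomp Require Import all_classical all_reals all_analysis.
From mathcomp Require Import ring lra zify.

Import Order.TTheory GRing.Theory Num.Theory.
Local Open Scope ring_scope.

(** Write c = wedge A Q and d = wedge B Q.  Since A and B are Farey neighbors
    with Q between them, a p - alpha q and beta q - b p are c and d up to a
    common sign, and a d + b c = q ([farey_configuration]).
    Put h = pi / q.  Reducing the angles a p h and b p h modulo pi turns the
    four coefficients of rho into polar form,
      (U, U') = S' (cos phi, sin phi),  (V, V') = S (cos psi, sin psi),
    with S = sin (a h) sin (b h) > 0 and S' = sin (c h) sin (d h) > 0, and with
    (phi, psi) representing the point where the maximum is claimed.  Hence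
    rho o iota is S' cos (u - phi) + S cos (v - psi), which is largest at
    (phi, psi), and U'' = S', V'' = S.  The same reduction gives
      Z = cos ((c - d) h) S + cos ((a + b) h) S',
    and the formula for Z is the product-to-sum identity, because
    x = a + b, y = |a - b|, x' = |c - d| and y' = c + d.

    What remains is that S, S' and Z are the sides of a nondegenerate triangle;
    positivity of Z is then a consequence.  In half angles, S + S' - Z is a
    combination of squares with positive coefficients, while Z + S - S' and
    Z + S' - S are 8 times a product of two differences such as
      sin A cos B cos C cos D - cos A sin B sin C sin D,
    where A, B, C, D are now a t, b t, c t, d t with t = h / 2
    ([triangle_of_tan]).  So everything reduces to the statement that each of
    the four tangents tan (a t), tan (b t), tan (c t), tan (d t) exceeds the
    product of the other three ([tan_lt_prod]).  By symmetry it is enough to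
    treat a.  The ratio tan (n x) / tan x increases with x, which yields
      tan (b t) tan (c t) <= tan t tan (b c t),
    and a d t + b c t = pi / 2 makes tan (b c t) the inverse of tan (a d t).
    Hence tan (b t) tan (c t) tan (d t) <= tan t tan (d t) / tan (a d t), which
    is at most tan (a t).  Equality is possible only when a = 1 and one of b, c
    is 1; the hypotheses on A, B, p and q exclude this, for all four
    tangents. *)

(** * The tangent inequality *)

Lemma tan_gt0_pihalf (R : realType) (x : R) : 0 < x < pi / 2 -> 0 < tan x.
Proof.
move=> /andP[x0 x1]; rewrite divr_gt0// ?sin_gt0_pihalf ?x0//.
by apply: cos_gt0_pihalf; lra.
Qed.

Lemma lt_tan_pihalf (R : realType) (x y : R) :
  0 < x -> x < y -> y < pi / 2 -> tan x < tan y.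
Proof.
by move=> x0 xy y1; rewrite ltr_tan ?in_itv/=; lra.
Qed.

(** By the addition formula tan ((n + 1) x) / tan x = (1 + r) / (1 - r tan^2 x)
    with r = tan (n x) / tan x, so if r does not decrease from x to y, then the
    left-hand side strictly increases.  The ratios are cross-multiplied. *)
Lemma tan_ratio_step (R : realType) (n : nat) (x y : R) :
    (0 < n)%N -> 0 < x -> x < y -> n.+1%:R * y < pi / 2 ->
    tan (n%:R * x) * tan y <= tan (n%:R * y) * tan x ->
  tan (n.+1%:R * x) * tan y < tan (n.+1%:R * y) * tan x.
Proof.
move=> n0 x0 xy y1 IH.
have n1 : 1 <= n%:R :> R by rewrite ler1n.
have nxy : n%:R * x < n%:R * y by rewrite ltr_pM2l// (lt_le_trans ltr01 n1).
have xnx : x <= n%:R * x by rewrite ler_peMl// ltW.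
move: y1; rewrite -natr1 ![(_ + 1) * _]mulrDl !mul1r => y1.
have cos0 (z : R) : 0 < z -> z < pi / 2 -> 0 < cos z.
  by move=> z0 z1; apply: cos_gt0_pihalf; lra.
have tan0 (z : R) : 0 < z -> z < pi / 2 -> 0 < tan z.
  by move=> z0 z1; apply: tan_gt0_pihalf; rewrite z0.
have tx0 : 0 < tan x by apply: tan0; lra.
have txy : tan x < tan y by apply: lt_tan_pihalf; lra.
have nx0 : 0 < tan (n%:R * x) by apply: tan0; lra.
have txny : tan (n%:R * x) < tan (n%:R * y) by apply: lt_tan_pihalf; lra.
have den0 : 0 < 1 - tan (n%:R * y) * tan y.
  have -> : 1 - tan (n%:R * y) * tan y =
            cos (n%:R * y + y) / (cos (n%:R * y) * cos y).
    have c1 : cos (n%:R * y) != 0 by rewrite gt_eqF// cos0; lra.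
    have c2 : cos y != 0 by rewrite gt_eqF// cos0; lra.
    by rewrite cosD /tan; field; rewrite c1 c2.
  by rewrite divr_gt0// ?mulr_gt0// cos0; lra.
have den_lt : 1 - tan (n%:R * y) * tan y < 1 - tan (n%:R * x) * tan x.
  by rewrite ltrD2l ltrN2 ltr_pM// ltW.
rewrite !tanD; try by rewrite gt_eqF// cos0; lra.
rewrite mulrAC [ltRHS]mulrAC ltr_pdivrMr ?(lt_trans den0)//.
rewrite [ltRHS]mulrAC ltr_pdivlMr//.
have N0 : 0 < (tan (n%:R * x) + tan x) * tan y.
  by rewrite mulr_gt0 ?addr_gt0// (lt_trans tx0).
apply: (@lt_le_trans _ _ ((tan (n%:R * x) + tan x) * tan y *
                          (1 - tan (n%:R * x) * tan x))).
  by rewrite ltr_pM2l.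
by rewrite ler_pM2r ?(lt_trans den0)//; lra.
Qed.

Lemma tan_ratio_le (R : realType) (n : nat) (x y : R) :
    0 < x -> x <= y -> n%:R * y < pi / 2 ->
  tan (n%:R * x) * tan y <= tan (n%:R * y) * tan x.
Proof.
move=> x0; rewrite le_eqVlt => /predU1P[-> //|xy].
elim: n => [|[_ _|n IH y1]]; first by rewrite !mul0r !tan0 !mul0r.
  by rewrite !mul1r mulrC.
apply/ltW/tan_ratio_step => //; apply: IH.
by apply: le_lt_trans y1; rewrite ler_pM2r ?ler_nat// (lt_trans x0).
Qed.

Lemma tan_ratio_lt (R : realType) (n : nat) (x y : R) :
    (1 < n)%N -> 0 < x -> x < y -> n%:R * y < pi / 2 ->
  tan (n%:R * x) * tan y < tan (n%:R * y) * tan x.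
Proof.
case: n => [|n]// n0 x0 xy y1; apply: tan_ratio_step => //.
apply: tan_ratio_le => //; first exact: ltW.
by apply: le_lt_trans y1; rewrite ler_pM2r ?ler_nat// (lt_trans x0).
Qed.

Lemma tan_cot (R : realType) (x y : R) :
  0 < x -> 0 < y -> x + y = pi / 2 -> tan x * tan y = 1.
Proof.
move=> x0 y0 xy; have -> : y = - (x - pi / 2) by lra.
have cx : 0 < cos x by apply: cos_gt0_pihalf; lra.
have sx : 0 < sin x by apply: sin_gt0_pihalf; lra.
rewrite /tan sinN cosN sinBpihalf cosBpihalf; field.
by rewrite !gt_eqF.
Qed.

(** The quantity a d + b c is unchanged by swapping a with d, by swapping b with
    c, and by swapping the pairs, so this inequality for one of the four
    tangents covers the other three. *)
Lemma tan_lt_prod (R : realType) (a b c d : nat) (t : R) :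
    (0 < a)%N -> (0 < b)%N -> (0 < c)%N -> (0 < d)%N ->
    (a * d + b * c)%:R * t = pi / 2 ->
    ~~ ((a == 1%N) && (b == 1%N)) -> ~~ ((a == 1%N) && (c == 1%N)) ->
  tan (b%:R * t) * tan (c%:R * t) * tan (d%:R * t) < tan (a%:R * t).
Proof.
move=> a0 b0 c0 d0; move Eq : (a * d + b * c)%N => q tq ab ac.
have q0 : (0 < q)%N by rewrite -Eq addn_gt0 muln_gt0 a0 d0.
have t0 : 0 < t.
  have : 0 < q%:R * t by rewrite tq divr_gt0// pi_gt0.
  by rewrite pmulr_rgt0// ltr0n.
have lt_pi k : (k < q)%N -> k%:R * t < pi / 2.
  by move=> kq; rewrite -tq ltr_pM2r// ltr_nat.
have gt_0 k : (0 < k)%N -> 0 < k%:R * t.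
  by move=> k0; rewrite mulr_gt0// ltr0n.
have tgt0 k : (0 < k < q)%N -> 0 < tan (k%:R * t).
  by move=> /andP[k0 k1]; rewrite tan_gt0_pihalf// gt_0// lt_pi.
have tlt k l : (0 < k)%N -> (k < l)%N -> (l < q)%N ->
    tan (k%:R * t) < tan (l%:R * t).
  move=> k0 kl lq; apply: lt_tan_pihalf; rewrite ?gt_0// ?lt_pi//.
  by rewrite ltr_pM2r// ltr_nat.
have bcq : (0 < b * c < q)%N by rewrite -Eq; nia.
have adq : (0 < a * d < q)%N by rewrite -Eq; nia.
have dq : (0 < d < q)%N by rewrite -Eq; nia.
have cot : tan ((b * c)%:R * t) * tan ((a * d)%:R * t) = 1.
  apply: tan_cot; rewrite ?gt_0 ?muln_gt0 ?a0 ?b0 ?c0//.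
  by rewrite -mulrDl -natrD addnC Eq.
have ct : 1%:R * t <= c%:R * t by rewrite ler_pM2r// ler_nat.
have bct : b%:R * (c%:R * t) < pi / 2.
  by rewrite mulrA -natrM lt_pi//; case/andP: bcq.
have D0 := tgt0 _ dq; have AD0 := tgt0 _ adq.
(* If a = 1 then tan (d t) is the inverse of tan (b c t), so strictness has to
   come from the ratio comparison, which requires b, c > 1.  If a > 1 it comes
   from tan t < tan (a t) and tan (d t) < tan (a d t). *)
have [a1|a1] := eqVneq a 1%N.
  subst a; rewrite mul1n in cot.
  have b1 : (1 < b)%N by case: b b0 ab {bcq cot bct Eq} => [|[]].
  have c1 : (1 < c)%N by case: c c0 ac {bcq cot bct Eq ct} => [|[]].
  have := @tan_ratio_lt R b (1%:R * t) (c%:R * t) b1.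
  rewrite (gt_0 1%N)// ltr_pM2r// ltr_nat => /(_ isT c1 bct).
  rewrite mul1r mulrA -natrM -(ltr_pM2r D0) => /lt_le_trans; apply.
  by rewrite mulrAC cot mul1r.
have := @tan_ratio_le R b (1%:R * t) (c%:R * t) (gt_0 1%N isT) ct bct.
rewrite mul1r mulrA -natrM -(ler_pM2r D0) => /le_lt_trans; apply.
have a2 : (1 < a)%N by case: a a0 a1 {ab ac Eq adq cot AD0} => [|[]].
have dad : (d < a * d)%N by nia.
apply: (@lt_trans _ _ (tan ((b * c)%:R * t) * tan t * tan ((a * d)%:R * t))).
  rewrite ltr_pM2l; first by apply: tlt => //; case/andP: adq.
  by rewrite mulr_gt0 ?tgt0// -[t]mul1r (tgt0 1%N)//; lia.
rewrite mulrAC cot mul1r -[X in tan X]mul1r (tlt 1%N)//.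
by rewrite -Eq; nia.
Qed.

(** * The triangle with sides S, S' and Z *)

(** With P = sin A cos B, P' = cos A sin B, K = cos C cos D and L = sin C sin D,
    one has S = 4 P P' and S' = 4 K L, so that Z + S - S' is
      8 (P P' (K + L)^2 - K L (P + P')^2) = 8 (P K - P' L) (P' K - P L),
    and each factor is positive by one of the tangent inequalities.  The
    factorization of Z + S' - S is the same with (A, B) and (C, D) exchanged. *)
Lemma triangle_of_tan (R : realType) (A B C D : R) :
    0 < A < pi / 2 -> 0 < B < pi / 2 -> 0 < C < pi / 2 -> 0 < D < pi / 2 ->
    tan B * tan C * tan D < tan A -> tan A * tan D * tan C < tan B ->
    tan A * tan D * tan B < tan C -> tan B * tan C * tan A < tan D ->
  let S := sin (A *+ 2) * sin (B *+ 2) in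
  let S' := sin (C *+ 2) * sin (D *+ 2) in
  let Z := cos (C *+ 2 - D *+ 2) * S + cos (A *+ 2 + B *+ 2) * S' in
  `|S - S'| < Z /\ Z < S + S'.
Proof.
have pos x : 0 < x < pi / 2 -> 0 < sin x /\ 0 < cos x.
  move=> /andP[x0 x1]; split; first by rewrite sin_gt0_pihalf ?x0.
  by apply: cos_gt0_pihalf; lra.
move=> /pos[sA cA] /pos[sB cB] /pos[sC cC] /pos[sD cD].
have clear_den x y z w : 0 < cos x -> 0 < cos y -> 0 < cos z -> 0 < cos w ->
    tan y * tan z * tan w < tan x ->
    0 < sin x * cos y * cos z * cos w - cos x * sin y * sin z * sin w.
  move=> cx cy cz cw; rewrite /tan -subr_gt0.
  have p0 : 0 < cos x * cos y * cos z * cos w by rewrite !mulr_gt0.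
  rewrite -(pmulr_rgt0 _ p0); congr (0 < _); field.
  by rewrite !gt_eqF.
move=> /clear_den hA /clear_den hB /clear_den hC /clear_den hD.
have {}hA := hA cA cB cC cD; have {}hB := hB cB cA cD cC.
have {}hC := hC cC cA cD cB; have {}hD := hD cD cB cC cA.
move=> S S' Z.
have cosB1 : cos (C *+ 2 - D *+ 2) = 1 - 2 * sin (C - D) ^+ 2.
  by rewrite -mulrnBl cos_mulr2n cos2sin2; ring.
have cosD1 : cos (A *+ 2 + B *+ 2) = 1 - 2 * sin (A + B) ^+ 2.
  by rewrite -mulrnDl cos_mulr2n cos2sin2; ring.
have cosB2 : cos (C *+ 2 - D *+ 2) = 2 * cos (C - D) ^+ 2 - 1.
  by rewrite -mulrnBl cos_mulr2n; ring.
have cosD2 : cos (A *+ 2 + B *+ 2) = 2 * cos (A + B) ^+ 2 - 1.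
  by rewrite -mulrnDl cos_mulr2n; ring.
have dbl x : 0 < sin x -> 0 < cos x -> 0 < sin (x *+ 2).
  by move=> sx cx; rewrite sin_mulr2n pmulrn_lgt0// mulr_gt0.
have S0 : 0 < S by apply: mulr_gt0; apply: dbl.
have S'0 : 0 < S' by apply: mulr_gt0; apply: dbl.
have Z1 : 0 < Z + S - S'.
  have -> : Z + S - S' = 8 *
      (sin A * cos B * cos C * cos D - cos A * sin B * sin C * sin D) *
      (sin B * cos A * cos D * cos C - cos B * sin A * sin D * sin C).
    rewrite /Z cosB2 cosD1 /S /S' !sin_mulr2n cosB sinD; ring.
  by rewrite !mulr_gt0.
have Z2 : 0 < Z + S' - S.
  have -> : Z + S' - S = 8 *
      (sin C * cos A * cos D * cos B - cos C * sin A * sin D * sin B) *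
      (sin D * cos B * cos C * cos A - cos D * sin B * sin C * sin A).
    rewrite /Z cosB1 cosD2 /S /S' !sin_mulr2n sinB cosD; ring.
  by rewrite !mulr_gt0.
have Z3 : 0 < S + S' - Z.
  have -> : S + S' - Z = 2 * (S * sin (C - D) ^+ 2 + S' * sin (A + B) ^+ 2).
    by rewrite /Z cosB1 cosD1; ring.
  rewrite mulr_gt0// ltr_wpDl//.
    by apply: mulr_ge0; rewrite ?sqr_ge0 ?(ltW S0).
  by apply: (mulr_gt0 S'0); rewrite exprn_gt0// sinD addr_gt0// mulr_gt0.
by split; [rewrite ltr_norml; apply/andP; split|]; lra.
Qed.

Lemma farey_cell_triangle (R : realType) (q a b c d : nat) :
    (0 < a)%N -> (0 < b)%N -> (0 < c)%N -> (0 < d)%N ->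
    (a * d + b * c)%N = q ->
    ~~ ((a == 1%N) && (b == 1%N)) -> ~~ ((c == 1%N) && (d == 1%N)) ->
    ~~ ((a == 1%N) && (c == 1%N)) -> ~~ ((b == 1%N) && (d == 1%N)) ->
  let h : R := pi / q%:R in
  let S := sin (a%:R * h) * sin (b%:R * h) in
  let S' := sin (c%:R * h) * sin (d%:R * h) in
  let Z := cos (c%:R * h - d%:R * h) * S + cos (a%:R * h + b%:R * h) * S' in
  [/\ 0 < S, 0 < S', `|S - S'| < Z & Z < S + S'].
Proof.
move=> a0 b0 c0 d0 cell ab cd ac bd h.
have q0 : 0 < q%:R :> R by rewrite ltr0n -cell addn_gt0 muln_gt0 a0 d0.
have qh : q%:R * h = pi by rewrite mulrC divfK// gt_eqF.
pose t : R := h / 2.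
have ht k : k%:R * h = (k%:R * t) *+ 2.
  by rewrite /t -mulrnAr -[_ *+ 2]mulr_natr divfK.
have qt : q%:R * t = pi / 2 by rewrite /t mulrA qh.
have h0 : 0 < h by rewrite divr_gt0// pi_gt0.
have t0 : 0 < t by rewrite divr_gt0.
have [aq bq] : (a < q)%N /\ (b < q)%N by rewrite -cell; split; nia.
have [cq dq] : (c < q)%N /\ (d < q)%N by rewrite -cell; split; nia.
have sin0 k : (0 < k)%N -> (k < q)%N -> 0 < sin (k%:R * h).
  move=> k0 kq; rewrite sin_gt0_pi// mulr_gt0 ?ltr0n//=.
  by rewrite -qh ltr_pM2r// ltr_nat.
have pos k : (0 < k)%N -> (k < q)%N -> 0 < k%:R * t < pi / 2.
  by move=> k0 kq; rewrite mulr_gt0 ?ltr0n//= -qt ltr_pM2r// ltr_nat.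
move=> S S' Z.
have [] : `|S - S'| < Z /\ Z < S + S'; last first.
  by split=> //; apply: mulr_gt0; apply: sin0.
rewrite /Z /S /S' !ht; apply: triangle_of_tan; rewrite ?pos//.
- by apply: tan_lt_prod => //; rewrite cell.
- by apply: tan_lt_prod => //; rewrite ?[(b * c + _)%N]addnC ?cell// andbC.
- apply: tan_lt_prod => //; last by rewrite andbC.
  by rewrite addnC [(c * b)%N]mulnC cell.
- apply: tan_lt_prod => //; rewrite 1?andbC//.
  by rewrite [(d * a)%N]mulnC cell.
Qed.

Lemma sine_product_difference (R : realType) (x y z w : R) :
  cos (z - w) * (sin x * sin y) + cos (x + y) * (sin z * sin w) =
  1 / 2 * (cos (z - w) * cos (x - y) - cos (x + y) * cos (z + w)).
Proof. by rewrite !cosB !cosD; field. Qed.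

(** * Farey neighbors around Q *)

(** Covers the slope at infinity: a coprime pair (u, 0) has u = 1. *)
Lemma wedge_fraction (u v s t : nat) : coprime u v -> coprime s t ->
  wedge (fraction u v) (fraction s t) = `|(u%:Z * t%:Z - v%:Z * s%:Z)%R|%N.
Proof.
have red k l : coprime k l ->
    slope_num (fraction k l) = k%:Z /\ slope_den (fraction k l) = l%:Z.
  rewrite /fraction; have [->|l0] := eqVneq l 0%N.
    by rewrite /coprime gcdn0 => /eqP ->.
  move=> kl; rewrite /slope_num /slope_den coprimeq_num// coprimeq_den//.
  by rewrite eqz_nat (negbTE l0) gtr0_sg ?ltz_nat ?lt0n// mul1r.
by move=> /red[nu du] /red[ns ds]; rewrite /wedge nu du ns ds.
Qed.

Lemma coprime_det1 (u v s t : nat) :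
  `|(u%:Z * t%:Z - v%:Z * s%:Z)%R|%N = 1%N -> coprime u v.
Proof.
move=> det1; rewrite /coprime -dvdn1 -det1.
suff : ((gcdn u v)%:Z %| u%:Z * t%:Z - v%:Z * s%:Z)%Z by rewrite dvdzE.
by rewrite rpredB// dvdz_mulr// dvdzE ?dvdn_gcdl ?dvdn_gcdr.
Qed.

Lemma ltr_fractionE (u v s t : nat) : (0 < v)%N -> (0 < t)%N ->
  (u%:Q / v%:Q < s%:Q / t%:Q) = (u * t < s * v)%N.
Proof.
move=> v0 t0; rewrite ltr_pdivrMr ?ltr0n// mulrAC ltr_pdivlMr ?ltr0n//.
by rewrite -!intrM ltr_int -!PoszM.
Qed.

(** The sign records on which side of Q the slope A lies.  Multiplying the
    determinant a beta - alpha b = +-1 by q gives a d + b c = q.  If a = c = 1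
    then A is 0 or 1, and |alpha q - p| = 1 forces p = 1 or p = q - 1; likewise
    for B. *)
Lemma farey_cell (q p alpha a beta b : nat) :
    (2 <= p)%N -> (p <= q - 2)%N -> (0 < a)%N -> (0 < b)%N ->
    (alpha <= a)%N -> (beta <= b)%N ->
    `|(alpha%:Z * b%:Z - a%:Z * beta%:Z)%R|%N = 1%N ->
    (alpha * q < p * a)%N && (p * b < beta * q)%N ||
    (beta * q < p * b)%N && (p * a < alpha * q)%N ->
  exists (e : bool) (c d : nat),
    [/\ (0 < c)%N && (0 < d)%N, (a * d + b * c = q)%N,
        a%:Z * p%:Z = alpha%:Z * q%:Z + (-1) ^+ e * c%:Z,
        b%:Z * p%:Z = beta%:Z * q%:Z - (-1) ^+ e * d%:Z
      & ~~ ((a == 1%N) && (c == 1%N)) && ~~ ((b == 1%N) && (d == 1%N))].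
Proof.
move=> p2 pq a0 b0 la lb det1 /orP[|] /andP[AQ QB].
- have det : (a * beta = alpha * b + 1)%N by nia.
  exists false, (p * a - alpha * q)%N, (beta * q - p * b)%N.
  rewrite expr0 !mul1r; split; [lia|nia|lia|lia|].
  apply/andP; split; apply/andP => -[/eqP x1 /eqP y1]; subst.
    by case: alpha {det det1 AQ QB} la y1 => [|[]]; lia.
  by case: beta {det det1 AQ QB} lb y1 => [|[]]; lia.
- have det : (alpha * b = a * beta + 1)%N by nia.
  exists true, (alpha * q - p * a)%N, (p * b - beta * q)%N.
  rewrite expr1 !mulN1r opprK; split; [lia|nia|lia|lia|].
  apply/andP; split; apply/andP => -[/eqP x1 /eqP y1]; subst.
    by case: alpha {det det1 AQ QB} la y1 => [|[]]; lia.
  by case: beta {det det1 AQ QB} lb y1 => [|[]]; lia.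
Qed.

(** The numerators and the denominators of Farey neighbors are ordered the same
    way: with opposite orders the determinant would exceed 1 in absolute value.
    Hence one sign serves for both differences. *)
Lemma farey_det_difference (alpha a beta b : nat) :
    (0 < a)%N -> (0 < b)%N -> a != b ->
    `|(alpha%:Z * b%:Z - a%:Z * beta%:Z)%R|%N = 1%N ->
  exists e : bool, [/\ `|alpha - beta|%N%:Z = (-1) ^+ e * (alpha%:Z - beta%:Z)
    & `|a - b|%N%:Z = (-1) ^+ e * (a%:Z - b%:Z)].
Proof.
move=> a0 b0 ab det1; have [ltab|leba] := ltnP a b.
  have : (alpha <= beta)%N.
    rewrite leqNgt; apply/negP => lt_beta.
    have := leq_mul lt_beta ltab; rewrite mulSn mulnS; lia.
  by exists true; rewrite expr1; split; lia.
have ltba : (b < a)%N by rewrite ltn_neqAle eq_sym ab.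
have : (beta <= alpha)%N.
  rewrite leqNgt; apply/negP => lt_alpha.
  have := leq_mul lt_alpha ltba; rewrite mulSn mulnS; lia.
by exists false; rewrite expr0; split; lia.
Qed.

(** Replacing A by the mediant or by the difference leaves the determinant with
    B equal to +-1. *)
Lemma farey_diagonals (alpha a beta b : nat) :
    (0 < a)%N -> (0 < b)%N -> a != b ->
    `|(alpha%:Z * b%:Z - a%:Z * beta%:Z)%R|%N = 1%N ->
  coprime (alpha + beta) (a + b) /\ coprime `|alpha - beta|%N `|a - b|%N.
Proof.
move=> a0 b0 ab det1; split.
  by apply: (@coprime_det1 _ _ beta b); rewrite -det1 !PoszD; congr absz; ring.
apply: (@coprime_det1 _ _ beta b).
have [e [-> ->]] := farey_det_difference _ _ _ _ a0 b0 ab det1.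
rewrite -!mulrA -mulrBr abszMsign -[RHS]det1; congr absz; ring.
Qed.

Lemma wedge_Infty (u v : nat) : coprime u v -> wedge (fraction u v) Infty = v.
Proof.
move=> uv; rewrite -[Infty]/(fraction 1 0) wedge_fraction// mulr0 mulr1 sub0r.
by rewrite abszN.
Qed.

(** All that the analytic part needs to know about A, B and Q.  The four
    excluded coincidences are those that [tan_lt_prod] has to avoid. *)
Lemma farey_configuration (q p alpha a beta b : nat) :
    (2 <= p)%N -> (p <= q - 2)%N -> coprime p q -> (0 < a)%N -> (0 < b)%N ->
    coprime alpha a -> coprime beta b ->
  let Q : rat := p%:Q / q%:Q in
  let A : rat := alpha%:Q / a%:Q in
  let B : rat := beta%:Q / b%:Q in
  let X := fraction (alpha + beta) (a + b) in
  let Y := fraction `|alpha - beta|%N `|a - b|%N in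
    A <= 1 -> B <= 1 -> farey_neighbor A B -> (A < Q < B) || (B < Q < A) ->
    ~~ (farey_neighbor A Q && farey_neighbor B Q) ->
    ~~ (farey_neighbor A Infty && farey_neighbor B Infty) ->
  exists (e : bool) (c d : nat),
  [/\ [/\ (0 < c)%N, (0 < d)%N, (a * d + b * c = q)%N,
          a%:Z * p%:Z = alpha%:Z * q%:Z + (-1) ^+ e * c%:Z
        & b%:Z * p%:Z = beta%:Z * q%:Z - (-1) ^+ e * d%:Z],
      [/\ ~~ ((a == 1%N) && (b == 1%N)), ~~ ((c == 1%N) && (d == 1%N)),
          ~~ ((a == 1%N) && (c == 1%N)) & ~~ ((b == 1%N) && (d == 1%N))]
    & [/\ wedge X Infty = (a + b)%N, wedge Y Infty = `|a - b|%N,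
          wedge X Q = `|c - d|%N & wedge Y Q = (c + d)%N]].
Proof.
move=> p2 pq copQ a0 b0 copA copB Q A B X Y.
have q0 : (0 < q)%N by move: p2 pq; clear; lia.
have Qfrac : Fin Q = fraction p q by rewrite /fraction gtn_eqF.
have Afrac : Fin A = fraction alpha a by rewrite /fraction gtn_eqF.
have Bfrac : Fin B = fraction beta b by rewrite /fraction gtn_eqF.
rewrite Qfrac Afrac Bfrac /farey_neighbor.
rewrite (wedge_Infty _ _ copA) (wedge_Infty _ _ copB).
rewrite !(wedge_fraction _ _ _ _ copA) // !(wedge_fraction _ _ _ _ copB)//.
rewrite /A /B /Q !ler_pdivrMr ?ltr0n// !mul1r !ler_int !ltr_fractionE//.
move=> {A B Q Afrac Bfrac Qfrac} lea leb /eqP det1 AQB cd1 ab1.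
have [e [c [d [/andP[c0 d0] cell Ec Ed /andP[ac1 bd1]]]]] :=
  farey_cell _ _ _ _ _ _ p2 pq a0 b0 lea leb det1 AQB.
(* If a = b, then a divides the determinant, so that a = b = 1. *)
have ab : a != b.
  apply: contra ab1 => /eqP ?; subst b; rewrite andbb -dvdn1 -det1.
  have : (a%:Z %| alpha%:Z * a%:Z - a%:Z * beta%:Z)%Z.
    by rewrite rpredB ?[(_ %| alpha%:Z * _)%Z]dvdz_mull ?dvdz_mulr ?dvdzz.
  by rewrite dvdzE.
have [copX copY] := farey_diagonals _ _ _ _ a0 b0 ab det1.
have [e' [Ealpha Ea]] := farey_det_difference _ _ _ _ a0 b0 ab det1.
exists e, c, d; split; split => //.
- move: cd1; rewrite Ec Ed opprD addNKr.
  by rewrite opprD opprK addNKr abszN !abszMsign.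
- by rewrite /X wedge_Infty.
- by rewrite /Y wedge_Infty.
- rewrite wedge_fraction// !PoszD !mulrDl Ec Ed.
  by rewrite -[RHS](abszMsign (~~ e)); congr absz; case: e {Ec Ed} => /=; ring.
- rewrite wedge_fraction// Ealpha Ea -!mulrA -mulrBr abszMsign !mulrBl Ec Ed.
  rewrite -[RHS]absz_nat -[RHS](abszMsign (~~ e)) PoszD; congr absz.
  by case: e {Ec Ed} => /=; ring.
Qed.

(** * The linear form on the torus *)

Lemma linear_form_iota (R : realType) (r s f g u v : R) :
  linear_form (row4 (r * cos f) (r * sin f) (s * cos g) (s * sin g))
              (iota_torus (torus_class u v)) =
  r * cos (u - f) + s * cos (v - g).
Proof.
rewrite /linear_form !big_ord_recl big_ord0 !mxE /=.
by rewrite !cos_circleE !sin_circleE !cosB; ring.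
Qed.

Lemma linear_form_iota_max (R : realType) (r s f g : R) : 0 <= r -> 0 <= s ->
  let rho := linear_form (row4 (r * cos f) (r * sin f) (s * cos g) (s * sin g))
  in forall t, rho (iota_torus t) <= rho (iota_torus (torus_class f g)).
Proof.
move=> r0 s0 rho [u v]; rewrite -[u]reprK -[v]reprK /rho.
rewrite -/(torus_class _ _) !linear_form_iota !subrr cos0.
by rewrite lerD// ler_wpM2l ?cos_le1.
Qed.

Lemma sqrt_polar (R : realType) (r f : R) : 0 <= r ->
  Num.sqrt ((r * cos f) ^+ 2 + (r * sin f) ^+ 2) = r.
Proof.
by move=> r0; rewrite !exprMn -mulrDr cos2Dsin2 mulr1 sqrtr_sqr ger0_norm.
Qed.

Lemma sin_shift (R : realType) (k : nat) (x : R) :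
  sin (x + pi *+ k) = (-1) ^+ k * sin x.
Proof. by rewrite (alternatingn (@sinDpi R)). Qed.

Lemma cos_shift (R : realType) (k : nat) (x : R) :
  cos (x + pi *+ k) = (-1) ^+ k * cos x.
Proof. by rewrite (alternatingn (@cosDpi R)). Qed.

Lemma cos_distn (R : realType) (k l : nat) (h : R) :
  cos (`|k - l|%N%:R * h) = cos (k%:R * h - l%:R * h).
Proof.
rewrite natr_absz -mulrBl intr_norm rmorphB /=.
by case: (ger0P (k%:R - l%:R : R)) => // _; rewrite mulNr cosN.
Qed.

Lemma sign_sin (R : realType) (e : bool) (x : R) :
  sin ((-1) ^+ e * x) = (-1) ^+ e * sin x.
Proof. by case: e; rewrite ?expr1 ?expr0 ?mulN1r ?sinN ?mul1r. Qed.

Lemma sign_cos (R : realType) (e : bool) (x : R) :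
  cos ((-1) ^+ e * x) = cos x.
Proof. by case: e; rewrite ?expr1 ?expr0 ?mulN1r ?cosN ?mul1r. Qed.

Lemma phase_shift (R : realType) (q p a alpha : nat) (s : int) : (0 < q)%N ->
    a%:Z * p%:Z = alpha%:Z * q%:Z + s ->
  a%:R * p%:R * (pi / q%:R) = s%:~R * (pi / q%:R) + pi *+ alpha :> R.
Proof.
move=> q0 /(congr1 (fun z : int => z%:~R : R)); rewrite intrD !intrM !pmulrn.
move=> ->; rewrite -!pmulrn -[pi *+ alpha]mulr_natr; field.
by rewrite pnatr_eq0 -lt0n.
Qed.

(** * The maximum and the triangle inequality *)

Theorem claim12 (R : realType) (q p : nat)
    (q_ge5 : (5 <= q)%N) (p_ge2 : (2 <= p)%N) (p_leq : (p <= q - 2)%N)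
    (coprime_pq : coprime p q)
    (alpha a beta b : nat) (a_ge1 : (1 <= a)%N) (b_ge1 : (1 <= b)%N)
    (coprime_A : coprime alpha a) (coprime_B : coprime beta b) :
  let Q : rat := p%:Q / q%:Q in
  let A : rat := alpha%:Q / a%:Q in
  let B : rat := beta%:Q / b%:Q in
  0 <= A <= 1 -> 0 <= B <= 1 ->
  farey_neighbor A B ->
  (A < Q < B) || (B < Q < A) ->
  ~~ (farey_neighbor A Q && farey_neighbor B Q) ->
  ~~ (farey_neighbor A Infty && farey_neighbor B Infty) ->
  let X : slope := fraction (alpha + beta) (a + b) in
  let Y : slope := fraction `|alpha - beta|%N `|a - b|%N in
  let x : R := (wedge X Infty)%:R in
  let y : R := (wedge Y Infty)%:R in
  let x' : R := (wedge X Q)%:R in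
  let y' : R := (wedge Y Q)%:R in
  let c : torus R :=
    torus_class ((a + b)%:R / q%:R * pi)
                ((p%:R * ((a + b)%:R / q%:R) - (alpha + beta)%:R) * pi) in
  let U : R := - (-1) ^+ (alpha + beta) * cos ((a + b)%:R * pi / q%:R)
                 * sin (a%:R * p%:R * pi / q%:R)
                 * sin (b%:R * p%:R * pi / q%:R) in
  let U' : R := - (-1) ^+ (alpha + beta) * sin ((a + b)%:R * pi / q%:R)
                  * sin (a%:R * p%:R * pi / q%:R)
                  * sin (b%:R * p%:R * pi / q%:R) in
  let V : R := (-1) ^+ (alpha + beta) * cos ((a + b)%:R * p%:R * pi / q%:R)
                 * sin (a%:R * pi / q%:R) * sin (b%:R * pi / q%:R) in
  let V' : R := (-1) ^+ (alpha + beta) * sin ((a + b)%:R * p%:R * pi / q%:R)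
                  * sin (a%:R * pi / q%:R) * sin (b%:R * pi / q%:R) in
  let rho : 'rV[R]_4 -> R := linear_form (row4 U U' V V') in
  let Z : R := (-1) ^+ (alpha + beta)
                 * (cos ((a + b)%:R * p%:R * pi / q%:R)
                      * sin (a%:R * pi / q%:R) * sin (b%:R * pi / q%:R)
                    - cos ((a + b)%:R * pi / q%:R)
                      * sin (a%:R * p%:R * pi / q%:R)
                      * sin (b%:R * p%:R * pi / q%:R)) in
  let U'' : R := Num.sqrt (U ^+ 2 + U' ^+ 2) in
  let V'' : R := Num.sqrt (V ^+ 2 + V' ^+ 2) in
  [/\ forall t : torus R, rho (iota_torus t) <= rho (iota_torus c),
      Z = 1 / 2 * (cos (x' / q%:R * pi) * cos (y / q%:R * pi)
                   - cos (x / q%:R * pi) * cos (y' / q%:R * pi)),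
      0 < Z
    & `|V'' - U''| < Z < V'' + U''].
Proof.
move=> Q A B /andP[_ A1] /andP[_ B1] AB AQB AQBQ AB1 X Y x y x' y' c U U' V V'
  rho Z U'' V''.
have [e [k [l [[k0 l0 cell Ek El] [ab1 kl1 ak1 bl1] [xE yE x'E y'E]]]]] :=
  farey_configuration _ _ _ _ _ _ p_ge2 p_leq coprime_pq a_ge1 b_ge1
    coprime_A coprime_B A1 B1 AB AQB AQBQ AB1.
have q0 : (0 < q)%N by case: (q) q_ge5.
pose h : R := pi / q%:R.
have hE (r : R) : r / q%:R * pi = r * h by rewrite mulrAC mulrA.
have hE' (r : R) : r * pi / q%:R = r * h by rewrite mulrA.
have aph : a%:R * p%:R * h = (-1) ^+ e * (k%:R * h) + pi *+ alpha.
  by rewrite (phase_shift _ _ _ _ _ _ q0 Ek) intrM intr_sign -mulrA.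
have bph : b%:R * p%:R * h = - ((-1) ^+ e * (l%:R * h)) + pi *+ beta.
  rewrite (phase_shift _ _ _ _ _ _ q0 El) mulrNz intrM intr_sign.
  by rewrite mulNr -mulrA.
pose phi := a%:R * h + b%:R * h.
pose psi := (-1) ^+ e * (k%:R * h - l%:R * h).
have abh : (a + b)%:R * h = phi by rewrite natrD mulrDl.
have abph : (a + b)%:R * p%:R * h = psi + pi *+ (alpha + beta).
  by rewrite natrD [_ * p%:R]mulrDl mulrDl aph bph mulrnDr /psi mulrBr addrACA.
have := farey_cell_triangle R _ _ _ _ _ a_ge1 b_ge1 k0 l0 cell ab1 kl1 ak1 bl1.
rewrite -/h; set S := sin (a%:R * h) * sin (b%:R * h).
set S' := sin (k%:R * h) * sin (l%:R * h) => /= -[S0 S'0 ZS ZS'].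
(* Modulo pi, the angles a p h and b p h reduce to k h and l h with opposite
   signs; this is where the minus sign comes from. *)
have sin_prod : (-1) ^+ (alpha + beta) *
    (sin (a%:R * p%:R * h) * sin (b%:R * p%:R * h)) = - S'.
  rewrite aph bph !sin_shift sinN !sign_sin /S' exprD.
  rewrite -[in RHS](signrMK e (_ * _)) -[in RHS](signrMK alpha (_ * _)).
  by rewrite -[in RHS](signrMK beta (_ * _)); ring.
have UE : U = S' * cos phi.
  by rewrite /U !hE' abh -[S']opprK -sin_prod; ring.
have U'E : U' = S' * sin phi.
  by rewrite /U' !hE' abh -[S']opprK -sin_prod; ring.
have VE : V = S * cos psi.
  by rewrite /V !hE' abph cos_shift signrMK -mulrA mulrC.
have V'E : V' = S * sin psi.
  by rewrite /V' !hE' abph sin_shift signrMK -mulrA mulrC.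
have ZE : Z = cos (k%:R * h - l%:R * h) * S + cos phi * S'.
  rewrite /Z !hE' abh abph cos_shift sign_cos -[S']opprK -sin_prod.
  by rewrite -[in RHS](signrMK (alpha + beta) (_ * S)) /S; ring.
have U''E : U'' = S' by rewrite /U'' UE U'E sqrt_polar// ltW.
have V''E : V'' = S by rewrite /V'' VE V'E sqrt_polar// ltW.
have cE : c = torus_class phi psi.
  rewrite /c hE abh; congr torus_class.
  by rewrite mulrBl mulrA hE [p%:R * _]mulrC abph mulr_natl addrK.
rewrite U''E V''E; split.
- by rewrite cE /rho UE U'E VE V'E; apply: linear_form_iota_max; apply: ltW.
- rewrite ZE sine_product_difference /x /y /x' /y' xE yE x'E y'E !hE !cos_distn.
  by rewrite abh natrD mulrDl.
- by rewrite ZE; apply: le_lt_trans ZS; apply: normr_ge0.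
- by rewrite ZE ZS.
Qed.
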